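(* For any target problem $(X,\mathcal F,T,P)$ there exists a unique optimal compatible projection $\pi$.
   Context: Standing setting. $(X,\mathcal X)$ is a measurable space and $T\in\mathcal X$ is a fixed set (the target). A random variable is a measurable $f:(X,\mathcal X)\to(\mathbb R,\mathcal B_{\mathbb R})$. $\pi_f$ is the equivalence relation $x\,\pi_f\,y\iff f(x)=f(y)$. Relations are ordered by inclusion as subsets of $X\times X$. It is assumed throughout that $(X,\mathcal X)$ satisfies (A0): for all random variables $f,g$, $\pi_f\subseteq\pi_g$ implies $\sigma(f)\supseteq\sigma(g)$ (so that $\sigma(f)$ is determined by $\pi_f$). Target problems. For a sub-$\sigma$-algebra $\mathcal F\subseteq\mathcal X$ with $T\in\mathcal F$, a transition probability on $(X,\mathcal F)$ is $P:X\times\mathcal F\to[0,1]$ with $P(x,\cdot)$ a probability measure on $\mathcal F$ for every $x\in X$ and $P(\cdot,F)$ $\mathcal F$-measurable for every $F\in\mathcal F$. A target problem is $(X,\mathcal F,T,P)$ with such $\mathcal F,P$. Compatible projections. A compatible projection for $(X,\mathcal F,T,P)$ is an equivalence relation of the form $\pi_f$, with $f$ a random variable such that $\sigma(f)\subseteq\mathcal F$ and $T\in\sigma(f)$, satisfying $P(x,F)=P(y,F)$ for all $x,y$ with $x\,\pi_f\,y$ and all $F\in\sigma(f)$. A compatible projection $\pi$ is optimal if $\pi\supseteq\pi'$ for every other compatible projection $\pi'$ for $(X,\mathcal F,T,P)$. *)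

(* Defs.v *)
From HB Require Import structures.
From mathcomp Require Import all_boot all_order all_algebra.
From mathcomp Require Import all_classical all_reals all_analysis.

Set Implicit Arguments.
Unset Strict Implicit.
Unset Printing Implicit Defensive.

Local Open Scope classical_set_scope.

Definition proj_rel (X Y : Type) (f : X -> Y) : set (X * X) :=
  [set xy | f xy.1 = f xy.2].

(* [g_sigma_algebra_preimage f] is sigma(f): the set of all preimages under f
   of Borel subsets of R. *)
Definition A0 (d : measure_display) (X : measurableType d) (R : realType) :
    Prop :=
  forall f g : {mfun X >-> R}, proj_rel f `<=` proj_rel g ->
    g_sigma_algebra_preimage g `<=` g_sigma_algebra_preimage f.

(* [g_sigma_algebraType F] is the carrier X endowed with the sigma-algebra
   generated by F, which is F itself since F is already a sigma-algebra
   ([measurable_g_measurableTypeE]). The measures [tp_trans x] take values in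
   [\bar R]; their values on sets outside F are irrelevant. *)
Record target_problem (d : measure_display) (X : measurableType d)
    (R : realType) (T : set X) := TargetProblem {
  tp_salg : set (set X) ;
  tp_sigma_algebra : sigma_algebra [set: X] tp_salg ;
  tp_measurable : tp_salg `<=` measurable ;
  tp_target : tp_salg T ;
  tp_trans :
    R.-pker (g_sigma_algebraType tp_salg) ~> (g_sigma_algebraType tp_salg)
}.

Definition compatible_projection (d : measure_display) (X : measurableType d)
    (R : realType) (T : set X) (p : target_problem R T) (pi : set (X * X)) :
    Prop :=
  exists f : {mfun X >-> R},
    [/\ pi = proj_rel f,
        g_sigma_algebra_preimage f `<=` tp_salg p,
        g_sigma_algebra_preimage f T &
        forall x y : X, proj_rel f (x, y) ->
          forall A : set X, g_sigma_algebra_preimage f A ->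
            tp_trans p x A = tp_trans p y A].

Definition optimal_projection (d : measure_display) (X : measurableType d)
    (R : realType) (T : set X) (p : target_problem R T) (pi : set (X * X)) :
    Prop :=
  compatible_projection p pi /\
  forall pi' : set (X * X), compatible_projection p pi' -> pi' `<=` pi.

(* Main.v *)
(* Closing {T} under finite intersections and under forming the sublevel sets
   {x | P(x, A) < q}, q rational, of its members A gives a countable pi-system C.
   Points with the same C-memberships agree on P(., A) for A in C, hence for A
   in sigma(C) by uniqueness of measures. A base-3 series of indicators of C is a
   sigma(C)-measurable f whose fibres are the C-atoms, so pi_f is compatible.
   Conversely, if pi_g is compatible then P(., A) is constant on g-fibres for A
   in sigma(g), so (A0) makes it sigma(g)-measurable; inductively C is included
   in sigma(g), that is, pi_g in pi_f. *)
Require Import Defs.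
From HB Require Import structures.
From mathcomp Require Import all_boot all_order all_algebra.
From mathcomp Require Import all_classical all_reals all_analysis.
From mathcomp Require Import measurable_realfun lra.

Import Order.TTheory GRing.Theory Num.Theory.

Local Open Scope classical_set_scope.
Local Open Scope ring_scope.

Definition ternary_partial {R : realType} (b : nat -> bool) (n : nat) : R :=
  \sum_(k < n) (b k)%:R * 3^-1 ^+ k.

(** The terms are nonnegative, so this supremum is the sum of the series; written with [sups], it is
    measurable as a countable supremum. *)
Definition ternary {R : realType} (b : nat -> bool) : R :=
  sups (ternary_partial b) 0%N.

Lemma ternary_partialS {R : realType} (b : nat -> bool) (n : nat) :
  ternary_partial b n.+1 = ternary_partial b n + (b n)%:R * 3^-1 ^+ n :> R.
Proof. by rewrite /ternary_partial big_ord_recr. Qed.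

(** Partial sums increase, which settles [n <= m]; beyond [m] the added terms are dominated by the
    geometric tail, of sum [3 / 2 * 3^-1 ^+ m]. *)
Lemma ternary_partial_le {R : realType} (b : nat -> bool) (m n : nat) :
  ternary_partial b n <= ternary_partial b m + 3 / 2 * 3^-1 ^+ m :> R.
Proof.
have pow_ge0 k : 0 <= 3^-1 ^+ k :> R by rewrite exprn_ge0.
have [/subnKC <-|/ltnW/subnKC <-] := leqP n m.
  apply: (@le_trans _ _ (ternary_partial b (n + (m - n))%N)); last first.
    by rewrite lerDl mulr_ge0.
  elim: (m - n)%N => [|j IH]; first by rewrite addn0.
  by rewrite addnS ternary_partialS (le_trans IH)// lerDl mulr_ge0.
set j := (n - m)%N.
(* The exact finite geometric sum is kept as the bound: the cruder one, without the subtracted term,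
   does not survive induction on [j]. *)
suff: ternary_partial b (m + j)%N <=
  ternary_partial b m + 3 / 2 * (3^-1 ^+ m - 3^-1 ^+ (m + j)) :> R.
  by have := pow_ge0 (m + j)%N; lra.
elim: j => [|j IH]; first by rewrite addn0 subrr mulr0 addr0.
rewrite addnS ternary_partialS exprS.
by have := pow_ge0 (m + j)%N; case: (b _) => /=; lra.
Qed.

Lemma has_ubound_ternary_partial {R : realType} (b : nat -> bool) :
  has_ubound (range (ternary_partial b : nat -> R)).
Proof.
by eexists => _ [n _ <-]; exact: (ternary_partial_le b 0%N).
Qed.

Lemma ternary_ge {R : realType} (b : nat -> bool) (n : nat) :
  ternary_partial b n <= ternary b :> R.
Proof.
apply: ub_le_sup; last by exists n.
have [M ubM] := @has_ubound_ternary_partial R b.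
by exists M => _ [k _ <-]; apply: ubM; exists k.
Qed.

Lemma ternary_le {R : realType} (b : nat -> bool) (n : nat) :
  ternary b <= ternary_partial b n + 3 / 2 * 3^-1 ^+ n :> R.
Proof.
apply: ge_sup; first by exists (ternary_partial b 0), 0%N.
by move=> _ [k _ <-]; exact: ternary_partial_le.
Qed.

(** At the first difference [c] gains [3^-1 ^+ n], whereas all later digits of [b] contribute at
    most half of that. In base 2 the two could be equal. *)
Lemma ternary_lt {R : realType} (b c : nat -> bool) (n : nat) :
  (forall k, (k < n)%N -> b k = c k) -> ~~ b n -> c n ->
  ternary b < ternary c :> R.
Proof.
move=> bc /negbTE bn cn; apply: le_lt_trans (ternary_le b n.+1) _.
apply: lt_le_trans (ternary_ge c n.+1).
rewrite !ternary_partialS bn cn mul0r mul1r addr0 exprS.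
have -> : ternary_partial b n = ternary_partial c n :> R.
  by apply: eq_bigr => k _; rewrite bc.
have : 0 < 3^-1 ^+ n :> R by rewrite exprn_gt0.
by lra.
Qed.

Lemma ternary_inj {R : realType} (b c : nat -> bool) :
  ternary b = ternary c :> R -> b =1 c.
Proof.
move=> bc n; elim/ltn_ind: n => n IH.
case bn: (b n); case cn: (c n) => //; exfalso.
- have := @ternary_lt R c b n (fun k kn => esym (IH k kn)) (negbT cn) bn.
  by rewrite bc ltxx.
- have := @ternary_lt R b c n IH (negbT bn) cn.
  by rewrite bc ltxx.
Qed.

Lemma measurable_ternary {d} {X : measurableType d} {R : realType}
    (C : (set X)^nat) : (forall n, measurable (C n)) ->
  measurable_fun setT (fun x => ternary (fun n => x \in C n) : R).
Proof.
move=> mC; apply: (@measurable_fun_sups _ _ _ _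
  (fun m x => ternary_partial (fun n => x \in C n) m)) => [x _|m].
  exact: has_ubound_ternary_partial.
apply: measurable_sum => k; apply: measurable_funM => //.
exact: measurable_indic.
Qed.

(* Syntax for the members of C, which makes C visibly countable. *)
Inductive expr : Type :=
| ExprT
| ExprTarget
| ExprI of expr & expr
| ExprLt of expr & rat.

Fixpoint tree_of_expr (e : expr) : GenTree.tree rat :=
  match e with
  | ExprT => GenTree.Node 0 [::]
  | ExprTarget => GenTree.Node 1 [::]
  | ExprI e1 e2 => GenTree.Node 2 [:: tree_of_expr e1; tree_of_expr e2]
  | ExprLt e1 q => GenTree.Node 3 [:: tree_of_expr e1; GenTree.Leaf q]
  end.

Fixpoint expr_of_tree (t : GenTree.tree rat) : option expr :=
  match t with
  | GenTree.Node 0 [::] => Some ExprT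
  | GenTree.Node 1 [::] => Some ExprTarget
  | GenTree.Node 2 [:: t1; t2] =>
    if (expr_of_tree t1, expr_of_tree t2) is (Some e1, Some e2)
    then Some (ExprI e1 e2) else None
  | GenTree.Node 3 [:: t1; GenTree.Leaf q] =>
    omap (ExprLt^~ q) (expr_of_tree t1)
  | _ => None
  end.

Lemma tree_of_exprK : pcancel tree_of_expr expr_of_tree.
Proof. by elim=> //= [e1 -> e2 ->|e -> q]. Qed.

HB.instance Definition _ := Countable.copy expr (pcan_type tree_of_exprK).

Section Family.
Context {d : measure_display} {X : measurableType d} {R : realType}.
Context {T : set X} (p : target_problem R T).

Let F := g_sigma_algebraType (tp_salg p).

Lemma measurable_tp (A : set F) : measurable A = tp_salg p A.
Proof.
have := @measurable_g_measurableTypeE X (tp_salg p) (tp_sigma_algebra p).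
by move=> ->.
Qed.

Fixpoint denote (e : expr) : set X :=
  match e with
  | ExprT => setT
  | ExprTarget => T
  | ExprI e1 e2 => denote e1 `&` denote e2
  | ExprLt e1 q => [set x | (tp_trans p x (denote e1) < (ratr q)%:E)%E]
  end.

Lemma denote_salg (e : expr) : tp_salg p (denote e).
Proof.
rewrite -measurable_tp; elim: e => [||e1 m1 e2 m2|e me q] /=.
- exact: measurableT.
- by rewrite measurable_tp; exact: tp_target.
- exact: measurableI.
- rewrite -[X in measurable X]setTI.
  apply: emeasurable_fun_infty_o => //.
  exact: measurable_kernel.
Qed.

Lemma trans_fin_num (x : X) (A : set X) :
  tp_salg p A -> tp_trans p x A \is a fin_num.
Proof.
by rewrite -measurable_tp => mA; exact: (finite_kernel_measure (tp_trans p)).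
Qed.

Lemma denote_compatible (hA0 : A0 X R) (g : {mfun X >-> R}) :
    g_sigma_algebra_preimage g T ->
    (forall x y, proj_rel g (x, y) -> forall A, g_sigma_algebra_preimage g A ->
       tp_trans p x A = tp_trans p y A) ->
  forall e, g_sigma_algebra_preimage g (denote e).
Proof.
move=> gT gP; elim=> [|//|e1 + e2|e ge q] /=.
- by exists setT => //; rewrite setTI preimage_setT.
- move=> [B1 mB1 <-] [B2 mB2 <-].
  by exists (B1 `&` B2); [exact: measurableI|rewrite !setTI preimage_setI].
(* (A0) concerns real random variables on X: [fine] loses nothing on finite values, and
   measurability for the smaller sigma-algebra passes to that of X. *)
have mP : measurable_fun [set: X] (fun x => fine (tp_trans p x (denote e))).
  apply: measurableT_comp => // _ B mB; apply: (@tp_measurable _ _ _ _ p).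
  rewrite -measurable_tp; apply: measurable_kernel => //.
  by rewrite measurable_tp; exact: denote_salg.
pose h : {mfun X >-> R} := mfun_Sub (mem_set mP).
apply: (hA0 g h).
  by move=> [x y] gxy; rewrite /proj_rel /= (gP x y gxy _ ge).
exists `]-oo, ratr q[%classic => //.
rewrite setTI; apply/seteqP; split=> x /=;
  by rewrite in_itv /= -lte_fin fineK//; exact: trans_fin_num (denote_salg e).
Qed.

(** The denotations form a pi-system containing the whole space, which has finite mass, so the
    constant sequence [setT] serves as the exhaustion in the uniqueness theorem for measures. *)
Lemma trans_eq (x y : X) :
    (forall e, denote e x <-> denote e y) ->
  forall A, <<s range denote >> A -> tp_trans p x A = tp_trans p y A.
Proof.
move=> xy; apply: (@g_sigma_algebra_measure_unique _ R F (range denote) _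
  (fun=> setT)).
- by move=> _ [e _ <-]; rewrite measurable_tp; exact: denote_salg.
- by move=> _; exists ExprT.
- by rewrite bigcup_const.
- by move=> _ _ [e1 _ <-] [e2 _ <-]; exists (ExprI e1 e2).
- move=> _ [e _ <-].
  have fx := trans_fin_num x _ (denote_salg e).
  have fy := trans_fin_num y _ (denote_salg e).
  rewrite -(fineK fx) -(fineK fy); congr EFin.
  (* If the two values differed, a rational [q] strictly between them would make [ExprLt e q]
     separate [x] from [y]. *)
  case: (ltgtP (fine (tp_trans p x (denote e)))
    (fine (tp_trans p y (denote e)))) => [/rat_in_itvoo[q]|/rat_in_itvoo[q]|//];
    rewrite in_itv /= -!lte_fin !fineK// => /andP[lq gq]; exfalso.
  + by move: ((xy (ExprLt e q)).1 lq) => /= /(lt_trans gq); rewrite ltxx.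
  + by move: ((xy (ExprLt e q)).2 lq) => /= /(lt_trans gq); rewrite ltxx.
- by move=> _; rewrite ltey_eq trans_fin_num//; exact: (denote_salg ExprT).
Qed.

End Family.

Theorem theorem3 (d : measure_display) (X : measurableType d) (R : realType)
    (T : set X) (mT : measurable T) (hA0 : A0 X R) (p : target_problem R T) :
  exists! pi : set (X * X), optimal_projection p pi.
Proof.
(* The default [setT] is already the denotation of [ExprT], so codes of no expression add no new
   set. *)
pose C n := if unpickle n is Some e then denote p e else setT.
have CE : range C = range (denote p).
  apply/seteqP; split=> [_ [n _ <-]|_ [e _ <-]].
    by rewrite /C; case: unpickle => [e|]; [exists e|exists ExprT].
  by exists (pickle e) => //; rewrite /C pickleK.
pose f x : R := ternary (fun n => x \in C n).
have sub_f : g_sigma_algebra_preimage f `<=` <<s range (denote p) >>.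
  (* Measurability is proved for the sigma-algebra generated by the denotations, since [trans_eq]
     reaches only its members. *)
  have mf : measurable_fun [set: g_sigma_algebraType (range (denote p))] f.
    apply: measurable_ternary => n; apply: sub_sigma_algebra.
    by rewrite -CE; exists n.
  by move=> _ [B mB <-]; exact: mf.
have sub_salg : <<s range (denote p) >> `<=` tp_salg p.
  apply: smallest_sub; first exact: tp_sigma_algebra.
  by move=> _ [e _ <-]; exact: denote_salg.
have mf : measurable_fun [set: X] f.
  move=> _ B mB; apply: (@tp_measurable _ _ _ _ p).
  by apply: sub_salg; apply: sub_f; exists B.
have f_denote x y : f x = f y <-> forall e, denote p e x <-> denote p e y.
  split=> [/ternary_inj fxy e|xy].
    have := fxy (pickle e); rewrite /C pickleK => xy.
    by split=> /mem_set; [rewrite xy|rewrite -xy] => /set_mem.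
  congr ternary; apply/funext => n; rewrite /C.
  case: unpickle => [e|]; last by rewrite !in_setT.
  by apply/idP/idP => /set_mem/xy/mem_set.
pose h : {mfun X >-> R} := mfun_Sub (mem_set mf).
have opt_h : optimal_projection p (proj_rel f).
  split.
    exists h; split=> //.
    - exact: subset_trans sub_f sub_salg.
    (* T belongs to sigma(f) by (A0): the indicator of T is constant on the fibres of [f], as
       [ExprTarget] is one of the expressions. *)
    - have mI : measurable_fun [set: X] (\1_T : X -> R).
        exact: measurable_indic.
      apply: (hA0 h (mfun_Sub (mem_set mI))).
        move=> [x y] /f_denote/(_ ExprTarget) /= xy.
        change (\1_T x = \1_T y :> R); rewrite !indicE; congr (nat_of_bool _)%:R.
        by apply/idP/idP => /set_mem/xy/mem_set.
      exists [set 1] => //; rewrite setTI.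
      rewrite [LHS]preimage_indic ifT ?inE// ifN// notin_setE => /esym/eqP.
      by rewrite oner_eq0.
    - by move=> x y /f_denote xy A /sub_f; exact: trans_eq.
  (* Each denotation is a preimage under [g], so it cannot separate two points with the same value
     of [g]. *)
  move=> _ [g [-> _ gT gP]] [x y] gxy; apply/f_denote => e.
  have [B _ <-] := denote_compatible p hA0 g gT gP e.
  by rewrite setTI /preimage /= gxy.
exists (proj_rel f); split=> // pi [pi_comp pi_max].
by apply/seteqP; split; [exact: pi_max opt_h.1|exact: opt_h.2 pi_comp].
Qed.
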